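(* Let $\mathcal{X}$ be an infinite dimensional complex Banach space, let $\mathcal{U}\subseteq B(\mathcal{X})$ be a standard operator algebra which does not contain the identity operator $I$, let $n\geq 2$ be a fixed integer, and let $\phi:\mathcal{U}\rightarrow\mathcal{U}$ be a linear map. The following are equivalent: (i) $\phi$ is a Lie $n$-centralizer; (ii) $\phi$ is an $n$-commuting map; (iii) there exists an element $\lambda\in\mathbb{C}$ such that $\phi(A)=\lambda A$ for all $A\in\mathcal{U}$.
   Context: All algebras and vector spaces are over $\mathbb{C}$. For a complex Banach space $\mathcal{X}$, $B(\mathcal{X})$ is the algebra of all bounded linear operators on $\mathcal{X}$ and $F(\mathcal{X})$ is its ideal of finite rank operators. A standard operator algebra over $\mathcal{X}$ is any subalgebra of $B(\mathcal{X})$ containing $F(\mathcal{X})$ (no closedness is assumed). For elements of an algebra $\mathcal{U}$, $[a,b]=ab-ba$, and $p_n$ is defined recursively by $p_1(a_1)=a_1$ and $p_n(a_1,\dots,a_n)=[p_{n-1}(a_1,\dots,a_{n-1}),a_n]$ for $n\geq 2$. A linear map $\phi:\mathcal{U}\to\mathcal{U}$ is a Lie $n$-centralizer ($n\geq2$) if $\phi(p_n(a_1,a_2,\dots,a_n))=p_n(\phi(a_1),a_2,\dots,a_n)$ for all $a_1,\dots,a_n\in\mathcal{U}$. A map $\varphi:\mathcal{U}\to\mathcal{U}$ is $n$-commuting ($n\geq 2$) if $p_n(\varphi(a),a,\dots,a)=0$ for all $a\in\mathcal{U}$. *)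

(* Defs.v *)
From HB Require Import structures.
From mathcomp Require Import all_boot all_order all_algebra.
From mathcomp Require Import all_classical all_reals all_analysis.
From mathcomp Require Export complex.

Set Implicit Arguments.
Unset Strict Implicit.
Unset Printing Implicit Defensive.

Import Order.TTheory GRing.Theory Num.Theory.
Import numFieldNormedType.Exports.

Local Open Scope classical_set_scope.
Local Open Scope ring_scope.

(* Associative algebras, with or without a unit. [algType] does not apply to
   the algebras at hand: it has a unit built in. *)
HB.mixin Record Lmodule_isNonUnitalAlgebra (K : pzRingType) V
    of GRing.Lmodule K V := {
  nmul : V -> V -> V;
  nmulA : associative nmul;
  nmulDl : left_distributive nmul +%R;
  nmulDr : right_distributive nmul +%R;
  nscalerAl : forall (k : K) a b, k *: nmul a b = nmul (k *: a) b;
  nscalerAr : forall (k : K) a b, k *: nmul a b = nmul a (k *: b)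
}.

#[short(type="nuAlgType")]
HB.structure Definition NonUnitalAlgebra (K : pzRingType) :=
  {V of Lmodule_isNonUnitalAlgebra K V & GRing.Lmodule K V}.

Section LiePolynomials.
Context {K : pzRingType} {V : nuAlgType K}.
Implicit Types (a b : V) (s : seq V).

Definition lie a b : V := nmul a b - nmul b a.

(* [lie_poly a1 [:: a2; ...; an]] is p_n(a1, ..., an); the recursion defining
   p_n is given by [lie_poly1] and [lie_poly_rcons]. *)
Definition lie_poly a s : V := foldl lie a s.

Lemma lie_poly1 a : lie_poly a [::] = a. Proof. by []. Qed.

Lemma lie_poly_rcons a s b : lie_poly a (rcons s b) = lie (lie_poly a s) b.
Proof. exact: foldl_rcons. Qed.

Definition lie_centralizer (n : nat) (phi : V -> V) : Prop :=
  forall (a : V) (s : (n.-1).-tuple V),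
    phi (lie_poly a s) = lie_poly (phi a) s.

Definition n_commuting (n : nat) (phi : V -> V) : Prop :=
  forall a : V, lie_poly (phi a) (nseq n.-1 a) = 0.

End LiePolynomials.

Section FiniteDimension.
Context {K : pzRingType} {V : lmodType K}.

Definition span_fam n (v : 'I_n -> V) : set V :=
  [set x | exists c : 'I_n -> K, x = \sum_(i < n) c i *: v i].

Definition finite_dim (S : set V) : Prop :=
  exists n (v : 'I_n -> V), S = span_fam v.

End FiniteDimension.

Section BoundedOperators.
Context {K : numFieldType} {X : normedModType K}.

Definition bounded_linear : {pred X -> X} :=
  mem [set f : X -> X | linear f /\ exists M : K, forall x, `|f x| <= M * `|x|].

Lemma bounded_linearP (f : X -> X) :
  reflect (linear f /\ exists M : K, forall x, `|f x| <= M * `|x|)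
          (f \in bounded_linear).
Proof. by apply: (iffP idP) => [/set_mem|?]//; apply/mem_set. Qed.

Lemma bounded_linear_submod : submod_closed bounded_linear.
Proof.
split.
  apply/bounded_linearP; split=> [a u v|]; first by rewrite scaler0 addr0.
  by exists 0 => x; rewrite normr0 mul0r.
move=> a f g /bounded_linearP[lf [M Mf]] /bounded_linearP[lg [N Ng]].
apply/bounded_linearP; split=> [k u v|].
  rewrite !fctE lf lg.
  by rewrite !scalerDr !scalerA [a * k]mulrC addrACA.
exists (`|a| * M + N) => x.
rewrite (le_trans (ler_normD _ _))// mulrDl lerD//.
by rewrite normrZ -mulrA ler_wpM2l.
Qed.

HB.instance Definition _ :=
  GRing.isSubmodClosed.Build K (X -> X) bounded_linear bounded_linear_submod.

Lemma bounded_linear_id : idfun \in bounded_linear.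
Proof.
by apply/bounded_linearP; split=> //; exists 1 => x; rewrite mul1r.
Qed.

Lemma bounded_linear_comp (f g : X -> X) :
  f \in bounded_linear -> g \in bounded_linear -> f \o g \in bounded_linear.
Proof.
move=> /bounded_linearP[lf [M Mf]] /bounded_linearP[lg [N Ng]].
apply/bounded_linearP; split=> [k u v /=|]; first by rewrite lg lf.
exists (`|M| * N) => x /=.
have [->|x0] := eqVneq x 0.
  have g0 : g 0 = 0 by have := lg (-1) 0 0; rewrite scaler0 addr0 scaleN1r addNr.
  have f0 : f 0 = 0 by have := lf (-1) 0 0; rewrite scaler0 addr0 scaleN1r addNr.
  by rewrite g0 f0 normr0 mulr0.
have nx0 : 0 < `|x| by rewrite normr_gt0.
have M0 : 0 <= M.
  have := le_trans (normr_ge0 _) (Mf x).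
  by rewrite pmulr_lge0.
rewrite ger0_norm//; apply: (le_trans (Mf _)).
by rewrite -mulrA ler_wpM2l.
Qed.

End BoundedOperators.

(* The algebra B(X) of bounded operators; its product, given by the [pzRingType]
   structure below, is composition. *)
Record bop (K : numFieldType) (X : normedModType K) := Bop {
  bop_fun :> X -> X;
  bop_boundedP : bop_fun \in bounded_linear
}.

HB.instance Definition _ (K : numFieldType) (X : normedModType K) := [isSub for @bop_fun K X].
HB.instance Definition _ (K : numFieldType) (X : normedModType K) :=
  [Choice of bop X by <:].
HB.instance Definition _ (K : numFieldType) (X : normedModType K) :=
  [SubChoice_isSubLmodule of bop X by <:].

Section BopRing.
Context {K : numFieldType} {X : normedModType K}.
Implicit Types A B : bop X.

Lemma bop_is_linear A : linear A.
Proof. by have /bounded_linearP[] := bop_boundedP A. Qed.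

HB.instance Definition _ A := GRing.isLinear.Build K X X _ A (bop_is_linear A).

Lemma bop_continuous A : continuous A.
Proof.
have /bounded_linearP[_ [M MA]] := bop_boundedP A.
apply: bounded_linear_continuous; apply/bounded_funP => r.
exists (`|M| * r) => x xr; apply: (le_trans (MA x)).
have [->|x0] := eqVneq x 0.
  by rewrite normr0 mulr0 mulr_ge0// (le_trans _ xr).
have M0 : 0 <= M.
  by have := le_trans (normr_ge0 _) (MA x); rewrite pmulr_lge0// normr_gt0.
by rewrite ger0_norm// ler_wpM2l.
Qed.

Definition bop_id : bop X := Bop bounded_linear_id.

Definition bop_comp A B : bop X :=
  Bop (bounded_linear_comp (bop_boundedP A) (bop_boundedP B)).

Lemma bop_compA : associative bop_comp.
Proof. by move=> A B C; apply: val_inj. Qed.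

Lemma bop_comp1 : left_id bop_id bop_comp.
Proof. by move=> A; apply: val_inj. Qed.

Lemma bop_compr1 : right_id bop_id bop_comp.
Proof. by move=> A; apply: val_inj. Qed.

Lemma bop_compDl : left_distributive bop_comp +%R.
Proof. by move=> A B C; apply: val_inj. Qed.

Lemma bop_compDr : right_distributive bop_comp +%R.
Proof. by move=> A B C; apply: val_inj; apply/funext => x /=; rewrite linearD. Qed.

HB.instance Definition _ := GRing.Zmodule_isPzRing.Build (bop X)
  bop_compA bop_comp1 bop_compr1 bop_compDl bop_compDr.

Lemma bop_scalerAl (k : K) A B : k *: (A * B) = (k *: A) * B.
Proof. exact: val_inj. Qed.

Lemma bop_scalerAr (k : K) A B : k *: (A * B) = A * (k *: B).
Proof. by apply: val_inj; apply/funext => x /=; rewrite linearZ. Qed.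

Definition finite_rank A : Prop := finite_dim (range A).

End BopRing.

Record stdOpAlg (K : numFieldType) (X : normedModType K) := StdOpAlg {
  soa_pred : {pred bop X};
  soa_submod : submod_closed soa_pred;
  soa_mul : GRing.mulr_2closed soa_pred;
  soa_finite_rank : forall A : bop X, finite_rank A -> A \in soa_pred
}.

Record soa_elt (K : numFieldType) (X : normedModType K) (U : stdOpAlg X) :=
  SoaElt { soa_val :> bop X; soa_valP : soa_val \in soa_pred U }.

Coercion soa_elt : stdOpAlg >-> Sortclass.

Section SoaAlgebra.
Context {K : numFieldType} {X : normedModType K} (U : stdOpAlg X).

HB.instance Definition _ :=
  GRing.isSubmodClosed.Build K (bop X) (soa_pred U) (soa_submod U).
HB.instance Definition _ := [isSub for @soa_val K X U].
HB.instance Definition _ := [Choice of U by <:].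
HB.instance Definition _ := [SubChoice_isSubLmodule of U by <:].

Definition soa_prod (A B : U) : U :=
  SoaElt (soa_mul (soa_valP A) (soa_valP B)).

Lemma soa_prodA : associative soa_prod.
Proof. by move=> A B C; apply: val_inj; apply: mulrA. Qed.

Lemma soa_prodDl : left_distributive soa_prod +%R.
Proof. by move=> A B C; apply: val_inj; apply: mulrDl. Qed.

Lemma soa_prodDr : right_distributive soa_prod +%R.
Proof. by move=> A B C; apply: val_inj; apply: mulrDr. Qed.

Lemma soa_scalerAl (k : K) A B : k *: soa_prod A B = soa_prod (k *: A) B.
Proof. by apply: val_inj; apply: bop_scalerAl. Qed.

Lemma soa_scalerAr (k : K) A B : k *: soa_prod A B = soa_prod A (k *: B).
Proof. by apply: val_inj; apply: bop_scalerAr. Qed.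

HB.instance Definition _ := Lmodule_isNonUnitalAlgebra.Build K U
  soa_prodA soa_prodDl soa_prodDr soa_scalerAl soa_scalerAr.

End SoaAlgebra.

(* Main.v *)
Require Import Defs.
From HB Require Import structures.
From mathcomp Require Import all_boot all_order all_algebra.
From mathcomp Require Import all_classical all_reals all_analysis.
From mathcomp Require Import complex ring.
Import Order.TTheory GRing.Theory Num.Theory.
Import numFieldNormedType.Exports.
Local Open Scope classical_set_scope.
Local Open Scope ring_scope.

(** Multiples of the identity map are Lie n-centralizers because the bracket is
    homogeneous, and a Lie n-centralizer is n-commuting because p_n(a, ..., a)
    is 0. What has content is that an n-commuting linear map [phi] is a multiple
    of the identity map.

    Bracketing with an idempotent [e] is a semisimple map ([lie_idem_cube]), so
    at an idempotent the commuting identity loses its higher powers: [phi e]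
    commutes with [e] ([n_commuting_idem]). Replacing [e] by [e + t *: x] and
    taking the coefficient of [t] gives a second identity that relates [phi x]
    to [phi e] ([n_commuting_idem_linearized]). For the rank one idempotent [e]
    given by a vector [u] and a bounded functional [f] with [f u = 1], these two
    read: [u] is an eigenvector of [phi e], with an eigenvalue l, and
    [phi x u = l *: x u - phi e (x u)] modulo the line of [u]
    ([rank_one_idem_identity]).

    If [x] has rank one, this makes every vector of its kernel an eigenvector of
    [phi x]; so [phi x] is a scalar on that kernel, and the scalar is 0 because
    the identity is not in [U] ([phi_rank_one_ker]). Applied to [x = e] this
    removes the term [phi e (x u)]: modulo the line of [u], [phi x u] is
    [l *: x u], where [l] depends only on [u] ([local_eigenvalue]). Testing on
    rank one operators whose range avoids the span of two given vectors, which
    is possible in infinite dimension, shows that [l] is the same for all [u]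
    ([local_eigenvalue_unique]). Then every vector is an eigenvector of
    [phi x - l *: x], which is therefore a scalar operator in [U], that is, 0.

    Rank one idempotents through a given vector exist by the complex
    Hahn-Banach theorem ([bounded_functional_eq1]). It is derived from the
    real one, where the functional is obtained as a minimal sublinear
    functional ([minimal_sublinear_linear]) without partial extensions. *)

(** * Brackets with an idempotent and n-commuting maps *)

Section LieBracket.
Context {K : pzRingType} {V : nuAlgType K}.
Implicit Types (a b c : V) (k : K) (s : seq V).

Lemma nmul0l a : nmul 0 a = 0.
Proof. by apply: (addrI (nmul 0 a)); rewrite -nmulDl !addr0. Qed.

Lemma nmul0r a : nmul a 0 = 0.
Proof. by apply: (addrI (nmul a 0)); rewrite -nmulDr !addr0. Qed.

Lemma nmulNl a b : nmul (- a) b = - nmul a b.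
Proof. by apply: (addrI (nmul a b)); rewrite -nmulDl !subrr nmul0l. Qed.

Lemma nmulNr a b : nmul a (- b) = - nmul a b.
Proof. by apply: (addrI (nmul a b)); rewrite -nmulDr !subrr nmul0r. Qed.

Lemma lieDl a b c : lie (a + b) c = lie a c + lie b c.
Proof. by rewrite /lie nmulDl nmulDr opprD addrACA. Qed.

Lemma lieDr a b c : lie a (b + c) = lie a b + lie a c.
Proof. by rewrite /lie nmulDl nmulDr opprD addrACA. Qed.

Lemma lieZl k a b : lie (k *: a) b = k *: lie a b.
Proof. by rewrite /lie -nscalerAl -nscalerAr scalerBr. Qed.

Lemma lieZr k a b : lie a (k *: b) = k *: lie a b.
Proof. by rewrite /lie -nscalerAl -nscalerAr scalerBr. Qed.

Lemma lie0l a : lie 0 a = 0.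
Proof. by rewrite /lie nmul0l nmul0r subrr. Qed.

Lemma liexx a : lie a a = 0.
Proof. by rewrite /lie subrr. Qed.

Lemma lie_poly0 s : lie_poly 0 s = 0.
Proof. by elim: s => //= a s IHs; rewrite /lie_poly /= lie0l. Qed.

Lemma lie_polyZ k a s : lie_poly (k *: a) s = k *: lie_poly a s.
Proof. by elim: s a => //= b s IHs a; rewrite /lie_poly /= lieZl; apply: IHs. Qed.

Lemma lie_sum_l (I : finType) (F : I -> V) a :
  lie (\sum_i F i) a = \sum_i lie (F i) a.
Proof.
by elim/big_rec2: _ => [|i x y _ <-]; [rewrite lie0l | rewrite lieDl].
Qed.

(** The Peirce decomposition of [e] splits the algebra into eigenspaces of
    [lie^~ e] for the eigenvalues 0, 1 and -1, so this map equals its cube. *)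
Lemma lie_idem_cube e a : nmul e e = e -> lie (lie (lie a e) e) e = lie a e.
Proof.
move=> ee; have eeA b : nmul e (nmul e b) = nmul e b by rewrite nmulA ee.
have Aee b : nmul (nmul b e) e = nmul b e by rewrite -nmulA ee.
rewrite /lie !(nmulDl, nmulDr, nmulNl, nmulNr) !(nmulA, Aee, ee).
rewrite !opprD !opprK !addrA.
by rewrite !subrK.
Qed.

(** Since [lie^~ e] equals its cube, it is semisimple: an element killed by one
    of its powers is already killed by the map itself. *)
Lemma lie_poly_idem_eq0 e a m :
  nmul e e = e -> lie_poly a (nseq m.+1 e) = 0 -> lie a e = 0.
Proof.
move=> ee; elim: m a => [//|m IHm] a /IHm aee.
by rewrite -lie_idem_cube// aee lie0l.
Qed.

End LieBracket.

Section VectorPolynomials.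
Context {K : numFieldType}.

(** Polynomial functions of a scalar with values in a module; they are needed
    only to extract a coefficient of an expression that vanishes for every value
    of the scalar. *)
Definition poly_map {V : lmodType K} (F : K -> V) : Prop :=
  exists n (c : nat -> V), forall t, F t = \sum_(k < n) t ^+ k *: c k.

(** Subtracting [2 ^+ n] times the value at [t] from the value at [2 * t] kills
    the top coefficient and multiplies each lower one by a nonzero scalar, which
    makes an induction on the degree possible. *)
Lemma poly_map_coef_eq0 (V : lmodType K) n (c : nat -> V) :
  (forall t, t != 0 -> \sum_(k < n) t ^+ k *: c k = 0) ->
  forall k, (k < n)%N -> c k = 0.
Proof.
elim: n c => // n IHn c c0.
have low k : (k < n)%N -> c k = 0.
  move=> kn; have : (2 ^+ k - 2 ^+ n : K) *: c k = 0.
    apply: (IHn (fun k => (2 ^+ k - 2 ^+ n : K) *: c k)) kn => t t0.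
    have := c0 (2 * t); rewrite mulf_neq0 ?pnatr_eq0// => /(_ isT).
    rewrite big_ord_recr/= exprMn -scalerA => /eqP; rewrite addr_eq0 => /eqP eq2.
    have := c0 t t0; rewrite big_ord_recr/= => /eqP; rewrite addr_eq0 => /eqP eq1.
    transitivity (\sum_(i < n) (2 * t) ^+ i *: c i -
                  2 ^+ n *: \sum_(i < n) t ^+ i *: c i).
      rewrite scaler_sumr -sumrB; apply: eq_bigr => i _.
      by rewrite !scalerA -scalerBl mulrBr exprMn ![t ^+ i * _]mulrC.
    by rewrite eq2 eq1 scalerN subrr.
  move/eqP; rewrite scaler_eq0 subr_eq0 => /orP[|/eqP//].
  move=> /eqP/ieexprIn; rewrite ltr0n pnatr_eq1 => /(_ isT isT) kn'.
  by rewrite kn' ltnn in kn.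
move=> k; rewrite ltnS leq_eqVlt => /orP[/eqP->|/low//].
have := c0 1 (oner_neq0 _); rewrite big_ord_recr/= expr1n scale1r.
by rewrite big1 ?add0r// => i _; rewrite low ?scaler0.
Qed.

Lemma poly_map_eq0 (V : lmodType K) (F : K -> V) :
  poly_map F -> (forall t, t != 0 -> F t = 0) -> F 0 = 0.
Proof.
move=> [n [c Fc]] F0; rewrite Fc big1// => k _.
by rewrite (@poly_map_coef_eq0 _ n c _ k)// ?scaler0// => t t0; rewrite -Fc F0.
Qed.

Lemma poly_map_lie (V : nuAlgType K) (F : K -> V) a x :
  poly_map F -> poly_map (fun t => lie (F t) (a + t *: x)).
Proof.
move=> [n [c Fc]]; exists n.+1.
exists (fun k => (if (k < n)%N then lie (c k) a else 0) +
                 (if k is k'.+1 then lie (c k') x else 0)) => t.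
under [RHS]eq_bigr do rewrite scalerDr.
rewrite big_split/= lieDr lieZr Fc !lie_sum_l; congr (_ + _).
  rewrite big_ord_recr/= ltnn scaler0 addr0.
  by apply: eq_bigr => i _; rewrite ltn_ord lieZl.
rewrite big_ord_recl/= scaler0 add0r scaler_sumr.
by apply: eq_bigr => i _; rewrite lieZl scalerA exprS.
Qed.

Lemma poly_map_lie_poly (V : nuAlgType K) (F : K -> V) a x m :
  poly_map F -> poly_map (fun t => lie_poly (F t) (nseq m (a + t *: x))).
Proof.
elim: m F => [//|m IHm] F polyF.
exact: (IHm (fun t => lie (F t) (a + t *: x)) (@poly_map_lie _ _ _ _ polyF)).
Qed.

Lemma poly_map_affine (V : lmodType K) (y z : V) :
  poly_map (fun t => y + t *: z).
Proof.
exists 2, (nth 0 [:: y; z]) => t.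
by rewrite !big_ord_recl big_ord0/= expr0 expr1 scale1r addr0.
Qed.

Lemma n_commuting_idem {V : nuAlgType K} {n} {phi : {linear V -> V}} {e : V} :
  (2 <= n)%N -> n_commuting n phi -> nmul e e = e -> lie (phi e) e = 0.
Proof.
case: n => [//|[//|m]] _ comm ee; exact: (@lie_poly_idem_eq0 _ _ _ _ m).
Qed.

(** The coefficient of [t] in the commuting identity at [e + t *: x]: because
    [phi e] commutes with [e], the first bracket is divisible by [t], and after
    that division the value at [t = 0] is a power of [lie^~ e] applied to the
    bracket below. Semisimplicity of [lie^~ e] removes the power. *)
Lemma n_commuting_idem_linearized {V : nuAlgType K} {n}
    {phi : {linear V -> V}} {e : V} (x : V) :
  (2 <= n)%N -> n_commuting n phi -> nmul e e = e ->
  lie (lie (phi e) x + lie (phi x) e) e = 0.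
Proof.
move=> n2 comm ee; have pe := n_commuting_idem n2 comm ee.
case: n n2 comm => [//|[//|m]] _ comm.
set z := lie (phi e) x + _.
have step t : lie_poly (phi (e + t *: x)) (nseq m.+1 (e + t *: x)) =
    t *: lie_poly (z + t *: lie (phi x) x) (nseq m (e + t *: x)).
  rewrite -lie_polyZ /lie_poly /=; congr foldl.
  rewrite linearD linearZ/= lieDl !lieDr !lieZl !lieZr pe add0r.
  by rewrite addrA -!scalerDr.
have z0 : lie_poly z (nseq m e) = 0.
  have := @poly_map_eq0 _ _
    (@poly_map_lie_poly _ _ e x m (poly_map_affine _ z (lie (phi x) x))).
  rewrite /= !scale0r !addr0; apply=> t t0.
  have : lie_poly (phi (e + t *: x)) (nseq m.+1 (e + t *: x)) = 0 by exact: comm.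
  by move=> /eqP; rewrite step scaler_eq0 (negPf t0) => /eqP.
apply: (@lie_poly_idem_eq0 _ _ _ _ m) => //.
(* One more bracket makes the exponent positive, also when [m = 0]. *)
by rewrite -(@addn1 m) nseqD /lie_poly foldl_cat -[foldl lie z _]/(lie_poly z _) z0 /= lie0l.
Qed.

End VectorPolynomials.

(** * The Hahn-Banach theorem for complex normed spaces *)

Section SublinearFunctionals.
Context {R : realType} {V : lmodType R}.
Implicit Types (p q : V -> R) (x y : V) (t : R).

(** Homogeneity is required as an inequality; applying it to the inverse scalar
    gives equality, see [sublinearZ]. *)
Definition sublinear q : Prop :=
  (forall x y, q (x + y) <= q x + q y) /\
  (forall t x, 0 < t -> q (t *: x) <= t * q x).

Lemma sublinearZ q t x : sublinear q -> 0 < t -> q (t *: x) = t * q x.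
Proof.
move=> [_ qZ] t0; apply/eqP; rewrite eq_le qZ//=.
have := qZ t^-1 (t *: x); rewrite invr_gt0 => /(_ t0).
by rewrite scalerA mulVf ?gt_eqF// scale1r mulrC ler_pdivlMr// mulrC.
Qed.

Lemma sublinear0 q : sublinear q -> q 0 = 0.
Proof.
move=> qS; have /eqP := sublinearZ q 2 0 qS (ltr0n _ 2).
rewrite scaler0 mulr_natl mulr2n -subr_eq0 opprD addrA subrr sub0r.
by rewrite oppr_eq0 => /eqP.
Qed.

Lemma sublinearN q x : sublinear q -> - q (- x) <= q x.
Proof.
move=> qS; rewrite -subr_ge0 opprK addrC.
by have := qS.1 (- x) x; rewrite addNr sublinear0// addrC.
Qed.

Lemma sublinear_odd_linear q : sublinear q -> (forall x, q (- x) <= - q x) ->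
  linear (q : V -> R^o).
Proof.
move=> qS qN.
have qodd x : q (- x) = - q x.
  by apply/eqP; rewrite eq_le qN/= lerNl sublinearN.
have qD x y : q (x + y) = q x + q y.
  apply/eqP; rewrite eq_le qS.1/= -[q (x + y)]opprK -qodd.
  by rewrite lerNr !opprD -!qodd qS.1.
move=> t x y; rewrite qD; congr (_ + _).
have [t0|t0|<-] := ltrgtP 0 t; first exact: sublinearZ.
  rewrite -[t *: x]opprK -scaleNr qodd sublinearZ ?oppr_gt0//.
  by rewrite mulNr opprK.
by rewrite !scale0r sublinear0.
Qed.

(** The largest sublinear functional below [q] whose value at [- y] is [- q y]:
    it makes [q] linear along the line of [y], hence a minimal [q] is equal to
    it for each [y]. *)
Definition slack q y x : R :=
  inf [set s | exists2 t, 0 <= t & s = q (x + t *: y) - t * q y].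

Section Slack.
Variables (q : V -> R) (y : V).
Hypothesis qS : sublinear q.

Lemma has_lbound_slack x :
  has_lbound [set s | exists2 t, 0 <= t & s = q (x + t *: y) - t * q y].
Proof.
exists (- q (- x)) => _ [t t0 ->].
rewrite lerBrDr addrC lerBlDr.
have tq : t * q y = q (t *: y).
  move: t0; rewrite le_eqVlt => /predU1P[<-|t0].
    by rewrite mul0r scale0r sublinear0.
  by rewrite sublinearZ.
rewrite tq; have := qS.1 (x + t *: y) (- x).
by rewrite addrAC subrr add0r.
Qed.

Lemma slack_le x t : 0 <= t -> slack q y x <= q (x + t *: y) - t * q y.
Proof. by move=> t0; apply: ge_inf; [exact: has_lbound_slack|exists t]. Qed.

Lemma le_slack x r :
  (forall t, 0 <= t -> r <= q (x + t *: y) - t * q y) -> r <= slack q y x.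
Proof.
move=> rq; apply: lb_le_inf; last by move=> _ [t t0 ->]; exact: rq.
by exists (q (x + 0 *: y) - 0 * q y); exists 0.
Qed.

Lemma slack_le_self x : slack q y x <= q x.
Proof. by have := slack_le x 0 (lexx _); rewrite scale0r addr0 mul0r subr0. Qed.

Lemma slack_opp : slack q y (- y) <= - q y.
Proof.
by have := slack_le (- y) 1 ler01; rewrite scale1r addNr mul1r sublinear0// sub0r.
Qed.

Lemma slack_sublinear : sublinear (slack q y).
Proof.
split=> [a b|t a t0].
  rewrite -lerBlDr; apply: le_slack => t t0.
  rewrite lerBlDr -lerBlDl; apply: le_slack => s s0.
  rewrite lerBlDl (le_trans (slack_le (a + b) (t + s) (addr_ge0 t0 s0)))//.
  rewrite scalerDl mulrDl opprD [leRHS]addrACA lerD2r addrACA; exact: qS.1.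
rewrite mulrC -ler_pdivrMr//; apply: le_slack => s s0.
rewrite ler_pdivrMr// (le_trans (slack_le (t *: a) (t * s) _))//.
  by rewrite mulr_ge0// ltW.
by rewrite -scalerA -scalerDr sublinearZ// -mulrA -mulrBr mulrC.
Qed.

End Slack.

(** Zorn's lemma: the pointwise infimum of a chain is again sublinear, and it is
    finite because [q x >= - q (- x) >= - p (- x)] for all [q] in the chain. *)
Lemma minimal_sublinear p : sublinear p ->
  exists q, [/\ sublinear q, forall x, q x <= p x &
    forall r, sublinear r -> (forall x, r x <= q x) -> r = q].
Proof.
move=> pS.
pose T := {q : V -> R | sublinear q /\ forall x, q x <= p x}.
pose below (q r : T) := `[< forall x, sval r x <= sval q x >].
have belowP (q r : T) : below q r -> forall x, sval r x <= sval q x by move/asboolP.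
have [||||q qmin] := @Zorn T below.
- by move=> q; apply/asboolP.
- move=> q r s /belowP qr /belowP rs; apply/asboolP => x.
  exact: le_trans (rs x) (qr x).
- move=> q r /belowP qr /belowP rq.
  apply: eq_sig_hprop => [f|]; first exact: Prop_irrelevance.
  by apply/funext => x; apply/eqP; rewrite eq_le qr rq.
- move=> A Atot.
  have [[q0 Aq0]|A0] := pselect (exists q : T, A q); last first.
    by exists (exist _ p (conj pS (fun=> lexx _))) => s As; case: A0; exists s.
  pose m x := inf [set s | exists2 q : T, A q & s = sval q x].
  have m_le (q : T) x : A q -> m x <= sval q x.
    move=> Aq; apply: ge_inf; last by exists q.
    exists (- p (- x)) => _ [r _ ->]; have [rS rp] := svalP r.
    by rewrite (le_trans _ (sublinearN _ x rS))// lerN2.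
  have le_m r x : (forall q : T, A q -> r <= sval q x) -> r <= m x.
    move=> rq; apply: lb_le_inf; last by move=> _ [q Aq ->]; exact: rq.
    by exists (sval q0 x); exists q0.
  have mS : sublinear m.
    split=> [x y|t x t0].
      rewrite -lerBlDr; apply: (le_m _) => q Aq.
      rewrite lerBlDr -lerBlDl; apply: (le_m _) => r Ar; rewrite lerBlDl.
      have [/belowP qr|/belowP rq] := Atot q r Aq Ar.
        rewrite (le_trans (m_le _ _ Ar))// (le_trans ((svalP r).1.1 x y))//.
        by rewrite lerD2r.
      rewrite (le_trans (m_le _ _ Aq))// (le_trans ((svalP q).1.1 x y))//.
      by rewrite lerD2l.
    rewrite mulrC -ler_pdivrMr//; apply: (le_m _) => q Aq.
    rewrite ler_pdivrMr// (le_trans (m_le _ _ Aq))// mulrC.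
    exact: (svalP q).1.2.
  have mp x : m x <= p x by rewrite (le_trans (m_le _ _ Aq0))// (svalP q0).2.
  by exists (exist _ m (conj mS mp)) => q Aq; apply/asboolP => x; exact: m_le.
have [qS qp] := svalP q; exists (sval q); split=> // r rS rq.
have rp x : r x <= p x by rewrite (le_trans (rq x)).
by have := qmin (exist _ r (conj rS rp)) (asboolT rq) => /(congr1 sval).
Qed.

(** By minimality [q] coincides with [slack q y] for every [y], which makes it
    odd, and an odd sublinear functional is linear. *)
Lemma minimal_sublinear_linear q : sublinear q ->
  (forall r, sublinear r -> (forall x, r x <= q x) -> r = q) ->
  linear (q : V -> R^o).
Proof.
move=> qS qmin; apply: sublinear_odd_linear => // y.
rewrite -{1}(qmin (slack q y)).
- exact: slack_opp.
- exact: slack_sublinear.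
- exact: slack_le_self.
Qed.

(** A minimal functional below [slack p u] does the job: being odd, it turns the
    bound [- p u] at [- u] into the lower bound [p u] at [u]. *)
Theorem hahn_banach_dominated p u : sublinear p ->
  exists f : V -> R,
    [/\ linear (f : V -> R^o), forall x, f x <= p x & f u = p u].
Proof.
move=> pS; have [f [fS fp fmin]] := minimal_sublinear _ (slack_sublinear _ u pS).
have flin := minimal_sublinear_linear _ fS fmin.
exists f; split=> // [x|].
  by rewrite (le_trans (fp x))// slack_le_self.
apply/eqP; rewrite eq_le (le_trans (fp u) (slack_le_self _ _ pS _))/=.
have := le_trans (fp (- u)) (slack_opp _ u pS).
have f0 := sublinear0 _ fS.
by have := flin (- 1) u 0; rewrite f0 !addr0 scaleN1r => ->; rewrite scaleN1r lerN2.
Qed.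

End SublinearFunctionals.

Section ComplexHahnBanach.
Context {R : realType}.

(** The real vector space underlying a complex one. *)
Definition realified (V : lmodType R[i]) : Type := V.

Section Realified.
Variable V : lmodType R[i].
HB.instance Definition _ := GRing.Zmodule.on (realified V).

Definition real_scale (t : R) (x : realified V) : realified V := t%:C%C *: (x : V).

Lemma real_scaleA s t x : real_scale s (real_scale t x) = real_scale (s * t) x.
Proof. by rewrite /real_scale scalerA rmorphM. Qed.

Lemma real_scale1 : left_id 1 real_scale.
Proof. by move=> x; rewrite /real_scale scale1r. Qed.

Lemma real_scaleDr : right_distributive real_scale +%R.
Proof. by move=> t x y; rewrite /real_scale scalerDr. Qed.

Lemma real_scaleDl x : {morph real_scale^~ x : s t / s + t}.
Proof. by move=> s t; rewrite /real_scale rmorphD scalerDl. Qed.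

HB.instance Definition _ := GRing.Zmodule_isLmodule.Build R (realified V)
  real_scaleA real_scale1 real_scaleDr real_scaleDl.
End Realified.

Definition bounded_functional {K : numFieldType} {X : normedModType K}
    (f : X -> K) : Prop :=
  linear (f : X -> K^o) /\ exists M : K, forall x, `|f x| <= M * `|x|.

Lemma bounded_functionalD {K : numFieldType} {X : normedModType K} {f : X -> K} :
  bounded_functional f -> {morph f : x y / x + y}.
Proof. by move=> [flin _] x y; have := flin 1 x y; rewrite !scale1r. Qed.

Lemma bounded_functional0 {K : numFieldType} {X : normedModType K} {f : X -> K} :
  bounded_functional f -> f 0 = 0.
Proof.
by move=> fb; apply: (addrI (f 0)); rewrite -(bounded_functionalD fb) !addr0.
Qed.

Lemma bounded_functionalZ {K : numFieldType} {X : normedModType K} {f : X -> K} :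
  bounded_functional f -> forall a x, f (a *: x) = a * f x.
Proof.
move=> fb a x; have := fb.1 a x 0.
by rewrite (bounded_functional0 fb) !addr0.
Qed.

Definition real_norm {X : normedModType R[i]} (x : X) : R := complex.Re `|x|.

Lemma real_normE (X : normedModType R[i]) (x : X) : (real_norm x)%:C%C = `|x|.
Proof. by rewrite /real_norm RRe_real// ger0_real. Qed.

Lemma real_norm_sublinear (X : normedModType R[i]) :
  sublinear (@real_norm X : realified X -> R).
Proof.
split=> [x y|t x t0]; rewrite -lecR.
  by rewrite rmorphD/= !real_normE ler_normD.
rewrite rmorphM/= !real_normE normrZ ler_wpM2r//.
by rewrite ger0_norm// lecR ltW.
Qed.

(** From a real-linear functional [g] with [g <= real_norm] and
    [g u = real_norm u] one gets the complex-linear functional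
    [g x - 'i * g ('i *: x)]; its real part at [u] is the norm of [u], so it can
    be rescaled to take the value 1 there. *)
Theorem bounded_functional_eq1 {X : normedModType R[i]} {u : X} : u != 0 ->
  exists2 f : X -> R[i], bounded_functional f & f u = 1.
Proof.
move=> u0.
have [g [glin gp gu]] :=
  hahn_banach_dominated _ (u : realified X) (real_norm_sublinear X).
have g0 : g 0 = 0 by have := glin (-1) 0 0; rewrite scaler0 addr0 scaleN1r addNr.
have gD (x y : X) : g (x + y) = g x + g y.
  by have := glin 1 x y; rewrite !scale1r.
have gZ (t : R) (x : X) : g (t%:C%C *: x) = t * g x.
  by have := glin t x 0; rewrite g0 !addr0.
have gN (x : X) : g (- x) = - g x.
  by have := glin (- 1) x 0; rewrite g0 !addr0 !scaleN1r.
have g_bounded (x : X) : `|(g x)%:C%C| <= `|x| :> R[i].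
  rewrite normc_def/= expr0n addr0 sqrtr_sqr -real_normE lecR ler_norml gp andbT.
  by rewrite lerNl -gN (le_trans (gp _))// -lecR !real_normE normrN.
pose f (x : X) : R[i] := (g x)%:C%C - 'i%C * (g ('i%C *: x))%:C%C.
have fD x y : f (x + y) = f x + f y.
  by rewrite /f scalerDr !gD !rmorphD/= mulrDr opprD addrACA.
have fZr (t : R) x : f (t%:C%C *: x) = t%:C%C * f x.
  rewrite /f scalerA [_ * t%:C%C]mulrC -scalerA !gZ !rmorphM/= mulrBr.
  by rewrite [t%:C%C * ('i%C * _)]mulrCA.
have fZi x : f ('i%C *: x) = 'i%C * f x.
  rewrite /f scalerA -expr2 sqr_i scaleN1r gN rmorphN/= mulrN opprK.
  by rewrite mulrBr mulrA -expr2 sqr_i mulN1r opprK addrC.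
have fZ a x : f (a *: x) = a * f x.
  rewrite [a]complexE scalerDl fD fZr -scalerA fZi fZr mulrDl.
  by rewrite mulrA.
have fu : f u != 0.
  apply/eqP => /(congr1 (@complex.Re R)); rewrite /f gu.
  rewrite /= !(mul0r, mul1r, mulr0, subr0, oppr0, addr0) => nu0.
  by move: u0; rewrite -normr_eq0 -real_normE nu0 eqxx.
exists (fun x => (f u)^-1 * f x); last by rewrite mulVf.
split=> [a x y|]; first by rewrite fD fZ mulrDr mulrCA.
exists (`|(f u)^-1| * 2) => x; rewrite normrM -mulrA ler_wpM2l//.
rewrite (le_trans (ler_normB _ _))// mulr_natl mulr2n lerD//.
rewrite normrM (le_trans (ler_wpM2l _ (g_bounded _)))// normrZ mulrA.
by rewrite -normrM -expr2 sqr_i normrN1 mul1r.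
Qed.

End ComplexHahnBanach.

(** * Rank one operators in a standard operator algebra *)

(** Two independent eigenvectors with distinct eigenvalues would have a sum that
    is not an eigenvector. *)
Lemma eigenvectors_scalar {K : fieldType} {V : lmodType K} (T : {linear V -> V})
    (W : V -> Prop) :
  (forall x y, W x -> W y -> W (x + y)) ->
  (forall x, W x -> exists c, T x = c *: x) ->
  exists c, forall x, W x -> T x = c *: x.
Proof.
move=> WD Teigen.
have [[u [Wu u0]]|W0] := pselect (exists u, W u /\ u != 0); last first.
  exists 0 => x Wx; have [->|x0] := eqVneq x 0; first by rewrite linear0 scaler0.
  by case: W0; exists x.
have [c Tu] := Teigen u Wu; exists c => x Wx.
have [b Tx] := Teigen x Wx; have [d] := Teigen _ (WD _ _ Wu Wx).
rewrite linearD/= Tu Tx => /eqP.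
rewrite scalerDr -subr_eq0 opprD addrACA -!scalerBl addr_eq0 => /eqP ud.
have [bd|bd] := eqVneq b d.
  move/eqP: ud; rewrite bd subrr scale0r oppr0 scaler_eq0 (negPf u0) orbF.
  by rewrite subr_eq0 => /eqP ->.
have xu : x = (d - b)^-1 * (c - d) *: u.
  rewrite -scalerA ud -scaleNr opprB scalerA mulVf ?scale1r//.
  by rewrite subr_eq0 eq_sym.
by rewrite -Tx [in LHS]xu linearZ/= Tu scalerA mulrC -scalerA -xu.
Qed.

(** If neither functional works for both vectors, their sum does. *)
Lemma functional_neq0_pair {K : numFieldType} {X : normedModType K}
    (f g : X -> K) (u v : X) :
  bounded_functional f -> bounded_functional g -> f u != 0 -> g v != 0 ->
  exists h : X -> K, [/\ bounded_functional h, h u != 0 & h v != 0].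
Proof.
move=> fb gb fu gv.
have [fv|] := eqVneq (f v) 0; last by exists f.
have [gu|] := eqVneq (g u) 0; last by exists g.
exists (fun x => f x + g x); split; last 2 first.
- by rewrite gu addr0.
- by rewrite fv add0r.
case: fb gb => [fl [M fM]] [gl [N gN]]; split=> [a x y|].
  by rewrite fl gl scalerDr addrACA.
by exists (M + N) => x; rewrite mulrDl (le_trans (ler_normD _ _))// lerD.
Qed.

Lemma exists_notin_span2 {K : numFieldType} {X : lmodType K} (u v : X) :
  ~ finite_dim [set: X] -> exists w, forall a b, w <> a *: u + b *: v.
Proof.
move=> Xinf; apply: contrapT => nw; apply: Xinf.
exists 2, (fun i => if i == ord0 then u else v).
apply/seteqP; split=> // w _; apply: contrapT => nwc; apply: nw.
exists w => a b wab; apply: nwc.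
exists (fun i => if i == ord0 then a else b).
by rewrite !big_ord_recl big_ord0 addr0.
Qed.

Section StandardOperatorAlgebra.
Context {K : numFieldType} {X : normedModType K} (U : stdOpAlg X).
Implicit Types (A B E : U) (w x z : X).

Lemma soa_prodE A B z : nmul A B z = A (B z).
Proof. by []. Qed.

Lemma soa_addE A B z : (A + B) z = A z + B z.
Proof. by []. Qed.

Lemma soa_oppE A z : (- A) z = - A z.
Proof. by []. Qed.

Lemma soa_scaleE k A z : (k *: A) z = k *: A z.
Proof. by []. Qed.

Lemma soa_lieE A B z : lie A B z = A (B z) - B (A z).
Proof. by []. Qed.

Lemma soa_ext A B : (forall z, A z = B z) -> A = B.
Proof. by move=> AB; do 2 apply: val_inj; apply/funext. Qed.

Lemma soa_rank_one w (h : X -> K) : bounded_functional h ->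
  exists E : U, forall z, E z = h z *: w.
Proof.
move=> hb; have [hlin [M hM]] := hb.
have Eb : (fun z => h z *: w) \in bounded_linear.
  apply/bounded_linearP; split=> [a x y|].
    by rewrite hlin scalerDl scalerA.
  exists (M * `|w|) => x; rewrite normrZ.
  by rewrite (le_trans (ler_wpM2r (normr_ge0 _) (hM x)))// mulrAC.
suff EU : Bop Eb \in soa_pred U by exists (SoaElt EU).
apply: soa_finite_rank.
have h0 := bounded_functional0 hb; have hZ := bounded_functionalZ hb.
have [[z hz]|hz0] := pselect (exists z, h z != 0).
  exists 1, (fun=> w); apply/seteqP; split=> y /=.
    by move=> [x _ <-]; exists (fun=> h x); rewrite big_ord1.
  move=> [c ->]; rewrite big_ord1; exists ((c ord0 / h z) *: z) => //.
  by rewrite /= hZ mulfVK.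
exists 0, (fun=> 0); apply/seteqP; split=> y /=.
  move=> [x _ <-]; exists (fun=> 0); rewrite big_ord0.
  have [->|hx] := eqVneq (h x) 0; first by rewrite scale0r.
  by case: hz0; exists x.
by move=> [c ->]; rewrite big_ord0; exists 0; rewrite //= h0 scale0r.
Qed.

(** A nonzero scalar operator in [U] would put the identity into [U]. *)
Lemma soa_scalar_eq0 A c : 1 \notin soa_pred U ->
  (forall z, A z = c *: z) -> A = 0.
Proof.
move=> I_notin Ac; have [c0|c0] := eqVneq c 0.
  by apply: soa_ext => z; rewrite Ac c0 scale0r.
case/negP: I_notin; have -> : 1 = soa_val (c^-1 *: A).
  apply: val_inj; apply/funext => z; transitivity (c^-1 *: A z) => //.
  by rewrite Ac scalerA mulVf ?scale1r.
exact: soa_valP.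
Qed.

End StandardOperatorAlgebra.

(** * Commuting maps are scalar *)

Section CommutingMap.
Context {R : realType} {X : normedModType R[i]} {U : stdOpAlg X}.
Variables (n : nat) (phi : {linear U -> U}).
Hypothesis n_ge2 : (2 <= n)%N.
Hypothesis phi_comm : n_commuting n phi.
Hypothesis I_notin_U : 1 \notin soa_pred U.

(** Apply both consequences of the commuting identity at the idempotent [E] to
    [u = E u]. The first makes [u] an eigenvector of [phi E]; in the second, all
    terms in which [E] acts last are multiples of [u]. *)
Lemma rank_one_idem_identity {f : X -> R[i]} {u : X} {E : U} :
  f u = 1 -> (forall z, E z = f z *: u) ->
  exists lambda, phi E u = lambda *: u /\
    forall A : U, exists c, phi A u = lambda *: A u - phi E (A u) + c *: u.
Proof.
move=> fu Ef; have Eu : E u = u by rewrite Ef fu scale1r.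
have EE : nmul E E = E.
  by apply: soa_ext => z; rewrite soa_prodE [E z]Ef linearZ/= Eu.
have [l Pu] : exists l, phi E u = l *: u.
  exists (f (phi E u)).
  have := congr1 (fun A : U => A u) (n_commuting_idem n_ge2 phi_comm EE).
  by rewrite soa_lieE Eu Ef => /eqP; rewrite subr_eq0 => /eqP.
exists l; split=> // A.
have := congr1 (fun A : U => A u)
  (n_commuting_idem_linearized A n_ge2 phi_comm EE).
rewrite soa_lieE Eu [E (_ u)]Ef soa_addE !soa_lieE Eu [E (_ u)]Ef Pu linearZ/=.
set d := f (_ + _); set a := f (phi A u) => /eqP.
rewrite subr_eq0 => /eqP yd; exists (d + a).
rewrite scalerDl -yd.
set p := phi E (A u); set q := l *: A u; set y := phi A u.
by rewrite [p - q + _]addrA subrK addrA -[q - p]opprB addNr add0r.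
Qed.

(** [rank_one_idem_identity] makes each vector of the kernel of [h] an eigenvector
    of [phi E], so [phi E] is a scalar plus a rank one operator that vanishes on
    this kernel. That rank one operator lies in [U], hence so does the scalar,
    which must be 0 because the identity is not in [U]. *)
Lemma phi_rank_one_ker {h : X -> R[i]} {w : X} {E : U} {u0 : X} :
  bounded_functional h -> h u0 = 1 -> (forall z, E z = h z *: w) ->
  forall z, h z = 0 -> phi E z = 0.
Proof.
move=> hb hu0 Eh.
have hD := bounded_functionalD hb; have hZ := bounded_functionalZ hb.
have [||c kerc] := eigenvectors_scalar (phi E) (fun z => h z = 0).
- by move=> y z hy hz; rewrite hD hy hz addr0.
- move=> z hz; have [->|z0] := eqVneq z 0.
    by exists 0; rewrite linear0 scaler0.
  have [f fb fz] := bounded_functional_eq1 z0.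
  have [F Ff] := soa_rank_one U z _ fb.
  have [l [_ /(_ E)[c]]] := rank_one_idem_identity fz Ff.
  by rewrite Eh hz scale0r !linear0 !add0r; exists c.
have [B Bh] := soa_rank_one U (phi E u0 - c *: u0) _ hb.
have phiEB0 : phi E - B = 0.
  apply: (@soa_scalar_eq0 _ _ _ _ c) => // z.
  rewrite soa_addE soa_oppE Bh.
  have : phi E (z - h z *: u0) = c *: (z - h z *: u0).
    by apply: kerc; rewrite -scaleNr hD hZ hu0 mulr1 subrr.
  rewrite linearB linearZ/= !scalerBr => /eqP; rewrite subr_eq => /eqP ->.
  by rewrite -addrA !scalerA [c * _]mulrC subKr subrK.
move=> z hz; have /eqP := phiEB0; rewrite subr_eq0 => /eqP ->.
by rewrite Bh hz scale0r.
Qed.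

(** In [rank_one_idem_identity] the term [phi E (A u)] is a multiple of [u], as
    [phi E] kills the kernel of [f] and has [u] as an eigenvector. *)
Lemma local_eigenvalue {u : X} : u != 0 ->
  exists lambda, forall A : U, exists c, phi A u = lambda *: A u + c *: u.
Proof.
move=> u0; have [f fb fu] := bounded_functional_eq1 u0.
have [E Ef] := soa_rank_one U u _ fb.
have fB x : f (x - f x *: u) = 0.
  rewrite -scaleNr (bounded_functionalD fb) (bounded_functionalZ fb) fu mulr1.
  by rewrite subrr.
have [l [Pu locl]] := rank_one_idem_identity fu Ef; exists l => A.
have [c phiA] := locl A.
have /eqP := phi_rank_one_ker fb fu Ef _ (fB (A u)).
rewrite linearB linearZ/= Pu subr_eq0 => /eqP PA.
exists (c - f (A u) * l).
by rewrite phiA PA scalerA scalerBl addrA [in RHS]addrAC.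
Qed.

(** Compare the two values on a rank one operator [E] with range spanned by a
    vector [w] outside the span of [u] and [v], and nonzero at [u] and [v]:
    since [phi E] kills a combination of [u] and [v] on which [E] vanishes,
    [(l - m) *: w] lies in that span. *)
Lemma local_eigenvalue_unique {u v : X} {l m : R[i]} :
  ~ finite_dim [set: X] -> u != 0 -> v != 0 ->
  (forall A : U, exists c, phi A u = l *: A u + c *: u) ->
  (forall A : U, exists c, phi A v = m *: A v + c *: v) ->
  l = m.
Proof.
move=> Xinf u0 v0 lu mv.
have [f fb fu] := bounded_functional_eq1 u0.
have [g gb gv] := bounded_functional_eq1 v0.
have [h [hb hu hv]] : exists h : X -> R[i],
    [/\ bounded_functional h, h u != 0 & h v != 0].
  by apply: (functional_neq0_pair f g) => //; rewrite ?fu ?gv oner_eq0.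
have [w w_notin] := exists_notin_span2 u v Xinf.
have [E Eh] := soa_rank_one U w _ hb.
have hZ := bounded_functionalZ hb.
have hu1 : h ((h u)^-1 *: u) = 1 by rewrite hZ mulVf.
have hker : h (- h v *: u + h u *: v) = 0.
  by rewrite (bounded_functionalD hb) !hZ mulNr mulrC addNr.
have := phi_rank_one_ker hb hu1 Eh _ hker.
have [c Eu] := lu E; have [d Ev] := mv E.
rewrite linearD !linearZ/= Eu Ev !Eh => eq0.
apply: contrapT => lm; pose k := (l - m) * (h u * h v).
have k0 : k != 0 by rewrite !mulf_neq0// subr_eq0; apply/eqP.
apply: (w_notin (k^-1 * (- h v * c)) (k^-1 * (h u * d))).
apply: (scalerI k0); rewrite scalerDr !scalerA !mulVKf//.
move: eq0; rewrite !scalerDr !scalerA addrACA -scalerDl => /eqP.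
rewrite addrC addr_eq0 => /eqP ->; rewrite -scaleNr; congr (_ *: _).
by rewrite /k; ring.
Qed.

(** With the common value [lambda], every vector is an eigenvector of
    [phi A - lambda *: A]; this element of [U] is a scalar operator, hence 0. *)
Lemma n_commuting_scalar : ~ finite_dim [set: X] ->
  exists lambda : R[i], forall A : U, phi A = lambda *: A.
Proof.
move=> Xinf.
have [w w0] := exists_notin_span2 (0 : X) 0 Xinf.
have {w0} w0 : w != 0 by apply/eqP => w00; apply: (w0 0 0); rewrite !scaler0 addr0.
have [l lw] := local_eigenvalue w0; exists l => A.
have [||c phiAc] := eigenvectors_scalar (phi A - l *: A) (fun=> True) => //.
  move=> z _; have [->|z0] := eqVneq z 0.
    by exists 0; rewrite linear0 scaler0.
  have [m mz] := local_eigenvalue z0.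
  have [c phiA] := mz A; exists c.
  transitivity (phi A z - l *: A z) => //.
  by rewrite phiA (local_eigenvalue_unique Xinf w0 z0 lw mz) addrAC subrr add0r.
apply/eqP; rewrite -subr_eq0; apply/eqP.
by apply: (@soa_scalar_eq0 _ _ _ _ c) => // z; exact: phiAc.
Qed.

End CommutingMap.

Theorem theorem5p5 (R : realType) (X : completeNormedModType R[i])
  (X_infinite_dim : ~ finite_dim [set: X])
  (U : stdOpAlg X) (I_notin_U : 1 \notin soa_pred U)
  (n : nat) (n_ge2 : (2 <= n)%N)
  (phi : {linear U -> U}) :
  (lie_centralizer n phi <-> n_commuting n phi) /\
  (n_commuting n phi <-> exists lambda : R[i], forall A : U, phi A = lambda *: A).
Proof.
have centralizer_commuting : lie_centralizer n phi -> n_commuting n phi.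
  case: n n_ge2 => [//|[//|m]] _ central A.
  have := central A [tuple of nseq m.+1 A].
  by rewrite /lie_poly /= liexx -/(lie_poly _ _) lie_poly0 linear0.
have commuting_scalar : n_commuting n phi ->
    exists lambda : R[i], forall A : U, phi A = lambda *: A.
  by move=> comm; exact: (n_commuting_scalar n phi).
have scalar_centralizer : (exists lambda : R[i], forall A : U, phi A = lambda *: A) ->
    lie_centralizer n phi.
  by move=> [l phil] A s; rewrite !phil lie_polyZ.
by split; split; auto.
Qed.
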